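(* Let $n\ge 1$ and $0\le k\le n$ be integers. Then $$\#\mathcal{P}_{2n,2k}^{+}=\frac{k}{n}\binom{2k}{k}\binom{2n-2k}{n-k}.$$
   Context: For integers $m\le n$ write $[m,n]=\{m,m+1,\dots,n\}$. For an integer $N\ge 0$, $\mathcal{P}_N$ is the set of all paths of simple random walk on $[0,N]$, i.e. all functions $X:[0,N]\to\mathbb{Z}$ with $X(0)=0$ and $|X(t)-X(t-1)|=1$ for all integers $1\le t\le N$. For a positive integer $t$, the path $X$ is ''on the positive side at $t$'' (equivalently, ''$X(t)$ is on the positive side'') if $X(t)\ge 0$ and $X(t-1)\ge 0$. The sojourn time $T_N$ of $X\in\mathcal{P}_N$ is $T_N=\#\{t\in\mathbb{Z}: 1\le t\le N,\ X(t)\text{ is on the positive side}\}$. $\mathcal{P}_{N,m}$ is the set of $X\in\mathcal{P}_N$ with $T_N=m$. For $N\ge 1$, $\mathcal{P}_N^{+}$ is the set of $X\in\mathcal{P}_N$ that are on the positive side at $N$, and $\mathcal{P}_{N,m}^{+}=\mathcal{P}_{N,m}\cap\mathcal{P}_N^{+}$. $\#$ denotes cardinality. *)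

(* Defs.v *)
From HB Require Import structures.
From mathcomp Require Import all_boot all_order all_algebra.

Set Implicit Arguments.
Unset Strict Implicit.
Unset Printing Implicit Defensive.

Import Order.TTheory GRing.Theory Num.Theory.
Local Open Scope ring_scope.

(* The time interval [0, N] is 'I_N.+1; the successor of t : 'I_N is
   lift ord0 t, and t itself is embedded by widen_ord. *)
Definition is_walk (N : nat) (X : {ffun 'I_N.+1 -> int}) : bool :=
  (X ord0 == 0) &&
  [forall t : 'I_N, `|X (lift ord0 t) - X (widen_ord (leqnSn N) t)| == 1].

Record walk (N : nat) := Walk {
  walk_val :> {ffun 'I_N.+1 -> int};
  walkP : is_walk walk_val
}.

HB.instance Definition _ N := [isSub for @walk_val N].
HB.instance Definition _ N := [Countable of walk N by <:].

(* A walk is determined by the set of times of its up-steps, so the set of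
   integer-valued walks is finite and #|_| applies to it. *)
Definition walk_steps N (X : walk N) : {ffun 'I_N -> bool} :=
  [ffun t => X (lift ord0 t) - X (widen_ord (leqnSn N) t) == 1].

Definition steps_walk N (s : {ffun 'I_N -> bool}) : option (walk N) :=
  insub [ffun t : 'I_N.+1 =>
    \sum_(i < N | (i < t)%N) (if s i then 1 else -1 : int)].

Lemma walk_stepsK N : pcancel (@walk_steps N) (@steps_walk N).
Proof.
move=> X; rewrite /steps_walk; set Y := finfun _.
suff -> : Y = val X by rewrite valK.
have /andP[/eqP X0 /forallP XS] := walkP X.
apply/ffunP => -[t tN]; rewrite ffunE /=.
elim: t tN => [|t IH] tN.
  rewrite big_pred0 //; rewrite -X0; congr (X _); exact: val_inj.
have tN' : (t < N)%N by [].
rewrite (bigD1 (Ordinal tN')) //=.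
rewrite (eq_bigl (fun i : 'I_N => (i < t)%N)); last first.
  by move=> i; rewrite -val_eqE /= ltnS ltn_neqAle andbC.
rewrite (IH (ltnW tN)) ffunE.
have -> : Ordinal tN = lift ord0 (Ordinal tN') by apply: val_inj.
have -> : Ordinal (ltnW tN) = widen_ord (leqnSn N) (Ordinal tN')
  by apply: val_inj.
have := XS (Ordinal tN'); rewrite eqr_norml ler01 andbT.
case: eqP => [<- _|_ /= /eqP <-]; by rewrite subrK.
Qed.

HB.instance Definition _ N : isFinite (walk N) := PCanIsFinite (@walk_stepsK N).

(* Time 0 is never counted; for t > 0, inord t.-1 is the time t - 1. *)
Definition pos_side (N : nat) (X : walk N) (t : 'I_N.+1) : bool :=
  [&& (0 < t)%N, 0 <= X t & 0 <= X (inord t.-1)].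

Definition sojourn (N : nat) (X : walk N) : nat :=
  #|[set t : 'I_N.+1 | pos_side X t]|.

Definition walks_sojourn (N m : nat) : {set walk N} :=
  [set X | sojourn X == m].

Definition walks_pos (N : nat) : {set walk N} :=
  [set X | pos_side X ord_max].

Definition walks_sojourn_pos (N m : nat) : {set walk N} :=
  walks_sojourn N m :&: walks_pos N.

(* Main.v *)
(* Cutting a walk at its last zero leaves a bridge followed by a walk of constant
   sign. By Chung-Feller, a bridge of length 2j has each of its j + 1 possible
   sojourn times in Catalan(j) ways, so the number of walks with given length,
   sojourn time and endpoint is a sum of Catalan numbers times ballot numbers.
   That sum, together with the Chung-Feller value at endpoint 0, satisfies the
   last-step recurrence of the walk counts; at endpoint 0 this amounts to the
   Catalan convolution, whose partial sums telescope. Forgetting the endpoint,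
   the number of walks ending above 0 then obeys a first-order recurrence in the
   sojourn time, solved by the stated product. *)
Require Import Defs.
From mathcomp Require Import all_boot all_order all_algebra.
From mathcomp Require Import zify ring lra.

Import GRing.Theory Num.Theory.
Local Open Scope ring_scope.

(** * Words and their sojourn times *)

(* A walk is encoded by its up-steps in reverse order: the head of the
   sequence is the last step. *)
Fixpoint pos (s : seq bool) : int :=
  if s is e :: s' then pos s' + (if e then 1 else -1) else 0.

Definition pos_edge (e : bool) (s : seq bool) : bool :=
  (0 <= pos s) && (0 <= pos (e :: s)).

Fixpoint soj (s : seq bool) : nat :=
  if s is e :: s' then (soj s' + pos_edge e s')%N else 0%N.

Lemma soj_le_size s : (soj s <= size s)%N.
Proof. by elim: s => //= e s IH; case: (pos_edge e s) => /=; lia. Qed.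

Fixpoint words (N : nat) : seq (seq bool) :=
  if N is N'.+1 then
    [seq true :: s | s <- words N'] ++ [seq false :: s | s <- words N']
  else [:: [::]].

Lemma mem_words N s : (s \in words N) = (size s == N).
Proof.
elim: N s => [|N IH] [|e s] //=; rewrite mem_cat.
  by apply/negP => /orP[] /mapP[].
have mem_cons e' : (e :: s \in [seq e' :: s0 | s0 <- words N]) =
    (e == e') && (size s == N).
  apply/mapP/andP => [[t tN [-> ->]]|[/eqP -> sN]].
    by rewrite -IH.
  by exists s; rewrite ?IH.
by rewrite !mem_cons eqSS; case: e {mem_cons} => //=; rewrite orbF.
Qed.

Lemma uniq_words N : uniq (words N).
Proof.
elim: N => //= N IH; rewrite cat_uniq !map_inj_uniq ?IH //=; last 2 first.
- by move=> ? ? [].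
- by move=> ? ? [].
by rewrite andbT; apply/hasPn => _ /mapP[s _ ->]; apply/mapP => -[].
Qed.

Lemma count_words_succ N (P : pred (seq bool)) :
  count P (words N.+1) =
  (count (fun s => P (true :: s)) (words N)
   + count (fun s => P (false :: s)) (words N))%N.
Proof. by rewrite /= count_cat !count_map. Qed.

(** * Bijection between walks and words *)

Section Encoding.
Variable N : nat.
Implicit Type X : walk N.

Fixpoint prefix_word X (t : nat) : seq bool :=
  if t is t'.+1 then
    (X (inord t'.+1) - X (inord t') == 1) :: prefix_word X t'
  else [::].

Lemma size_prefix_word X t : size (prefix_word X t) = t.
Proof. by elim: t => //= t ->. Qed.

Lemma pos_prefix_word X t : (t <= N)%N -> pos (prefix_word X t) = X (inord t).
Proof.
have /andP[/eqP X0 /forallP XS] := walkP X.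
elim: t => [|t IH] tN /=.
  by rewrite -X0; congr (walk_val X _); apply: val_inj; rewrite /= inordK.
rewrite (IH (ltnW tN)).
have := XS (Ordinal tN).
have -> : lift ord0 (Ordinal tN) = inord t.+1.
  by apply: val_inj; rewrite /= inordK.
have -> : widen_ord (leqnSn N) (Ordinal tN) = inord t.
  by apply: val_inj; rewrite /= inordK // ltnW.
rewrite eqr_norml ler01 andbT => /orP[] /eqP E; rewrite E //=; lia.
Qed.

Lemma soj_prefix_word X t : (t <= N)%N ->
  soj (prefix_word X t) = (\sum_(1 <= i < t.+1) pos_side X (inord i))%N.
Proof.
elim: t => [|t IH] tN; first by rewrite big_geq.
rewrite big_nat_recr //= IH 1?ltnW // /pos_edge -/(prefix_word X t.+1).
rewrite !pos_prefix_word ?(ltnW tN) // /pos_side inordK //=.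
by rewrite [in RHS]andbC.
Qed.

Lemma soj_walk X : soj (prefix_word X N) = sojourn X.
Proof.
rewrite soj_prefix_word // /sojourn -sum1dep_card [in RHS]big_mkcond.
rewrite big_ord_recl /=.
rewrite big_add1 /= big_mkord; apply: eq_bigr => i _.
have -> : inord i.+1 = lift ord0 i.
  by apply: val_inj; rewrite /= inordK ?ltnS ?ltn_ord.
by case: pos_side.
Qed.

(** Since the head is the last step, the words of all earlier times are suffixes of the full word,
    which thus determines every position. *)
Lemma prefix_word_inj : injective (fun X => prefix_word X N).
Proof.
have drop_prefix X d : drop d (prefix_word X N) = prefix_word X (N - d).
  elim: d => [|d IH]; first by rewrite drop0 subn0.
  rewrite -add1n -drop_drop IH subnS.
  by case: (N - d)%N => //= m; rewrite drop0.
move=> X Y /= E; apply/val_inj/ffunP => t /=.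
have tN : (t <= N)%N by rewrite -ltnS.
rewrite -[t]inord_val -!pos_prefix_word //.
by rewrite -(subKn tN) -!drop_prefix E.
Qed.

Lemma prefix_word_surj s : size s = N -> {X | prefix_word X N = s}.
Proof.
move=> sN; pose Y := [ffun t : 'I_N.+1 => pos (drop (N - t) s)].
have drop_succ t : (t < N)%N ->
    drop (N - t.+1) s = nth true s (N - t.+1) :: drop (N - t) s.
  by move=> tN; rewrite (drop_nth true) ?sN ?subnSK //; lia.
have walkY : is_walk Y.
  apply/andP; split; first by rewrite ffunE subn0 -sN drop_size.
  apply/forallP => t; rewrite !ffunE /= /bump /= add1n drop_succ //=.
  by case: nth; apply/eqP; lia.
exists (Walk walkY).
suff H t : (t <= N)%N -> prefix_word (Walk walkY) t = drop (N - t) s.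
  by rewrite H // subnn drop0.
elim: t => [|t IH] tN; first by rewrite subn0 drop_oversize ?sN.
rewrite /= (IH (ltnW tN)) drop_succ // !ffunE !inordK // 1?ltnW //.
rewrite drop_succ //=; congr cons.
by case: nth; apply/eqP; lia.
Qed.

Lemma card_walks (P : pred (seq bool)) :
  #|[set X : walk N | P (prefix_word X N)]| = count P (words N).
Proof.
rewrite cardE -(size_map (fun X => prefix_word X N)) -size_filter.
apply/perm_size/uniq_perm.
- by rewrite (map_inj_uniq prefix_word_inj) enum_uniq.
- by rewrite filter_uniq // uniq_words.
move=> s; rewrite mem_filter mem_words.
apply/mapP/andP => [[X] |[Ps /eqP sN]].
  by rewrite mem_enum inE => PX ->; rewrite size_prefix_word.
have [X Xs] := prefix_word_surj s sN.
by exists X; rewrite // mem_enum inE Xs.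
Qed.

End Encoding.

Lemma card_walks_sojourn_pos N m :
  #|walks_sojourn_pos N.+1 m| =
  count (fun s => (soj s == m) && pos_edge (head true s) (behead s))
        (words N.+1).
Proof.
rewrite -card_walks; apply: eq_card => X; rewrite !inE soj_walk; congr (_ && _).
change (pos_side X ord_max =
  (0 <= pos (prefix_word _ X N)) && (0 <= pos (prefix_word _ X N.+1))).
rewrite !pos_prefix_word //.
rewrite /pos_side /= andbC; congr (_ && _).
by congr (_ <= walk_val X _); apply: val_inj; rewrite /= inordK.
Qed.

Lemma count_eq_pred0 (T : Type) (P : pred T) (r : seq T) :
  P =1 pred0 -> count P r = 0%N.
Proof. by move/eq_count->; exact: count_pred0. Qed.

(** * Last-step recurrences for the walk counts *)

Definition nb_end (N m : nat) (x : int) : nat :=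
  count (fun s => (pos s == x) && (soj s == m)) (words N).

Definition nb_above (N m : nat) : nat :=
  count (fun s => (0 < pos s) && (soj s == m)) (words N).

Lemma nb_end_gt N m x : (N < m)%N -> nb_end N m x = 0%N.
Proof.
move=> Nm; apply/eqP; rewrite eqn0Ngt -has_count; apply/hasPn => s.
rewrite mem_words => /eqP sN; apply/negP => /andP[_ /eqP sm].
by have := soj_le_size s; rewrite sm sN leqNgt Nm.
Qed.

(** A last step ending above 0 always adds to the sojourn time; one ending below 0 never does, and
    one ending at 0 does only when it comes from 1. *)
Lemma nb_end_pos N m (x : nat) :
  nb_end N.+1 m.+1 x.+1%:Z = (nb_end N m x%:Z + nb_end N m x.+2%:Z)%N.
Proof.
rewrite /nb_end count_words_succ; congr addn; apply: eq_count => s.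
all: by rewrite /= /pos_edge /=; lia.
Qed.

Lemma nb_end_pos0 N (x : nat) : nb_end N.+1 0 x.+1%:Z = 0%N.
Proof.
rewrite /nb_end count_words_succ -[RHS]addn0.
by congr addn; apply: count_eq_pred0 => s; rewrite /= /pos_edge /=; lia.
Qed.

Lemma nb_end_neg N m (x : nat) :
  nb_end N.+1 m (- x.+1%:Z) = (nb_end N m (- x.+2%:Z) + nb_end N m (- x%:Z))%N.
Proof.
rewrite /nb_end count_words_succ; congr addn; apply: eq_count => s.
all: by rewrite /= /pos_edge /=; lia.
Qed.

Lemma nb_end_zero N m :
  nb_end N.+1 m.+1 0 = (nb_end N m.+1 (-1) + nb_end N m 1)%N.
Proof.
rewrite /nb_end count_words_succ; congr addn; apply: eq_count => s.
all: by rewrite /= /pos_edge /=; lia.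
Qed.

Lemma nb_end_zero0 N : nb_end N.+1 0 0 = nb_end N 0 (-1).
Proof.
rewrite /nb_end count_words_succ -[RHS]addn0.
congr addn; [apply: eq_count | apply: count_eq_pred0] => s.
all: by rewrite /= /pos_edge /=; lia.
Qed.

(** A walk above 0 extends in two ways, one of which is lost when it stands at 1, and a walk at 0
    extends upwards; all these steps lie on the positive side. The lost term is moved to the left to
    stay in [nat]. *)
Lemma nb_above_succ N m :
  (nb_above N.+1 m.+1 + nb_end N m 1 = 2 * nb_above N m + nb_end N m 0)%N.
Proof.
rewrite /nb_above count_words_succ /nb_end.
elim: (words N) => //= s w; rewrite /pos_edge /=; lia.
Qed.

Lemma nb_above_zero N : nb_above N 0 = 0%N.
Proof.
case: N => // N; rewrite /nb_above count_words_succ -[RHS]addn0.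
by congr addn; apply: count_eq_pred0 => s; rewrite /= /pos_edge /=; lia.
Qed.

(** From above 0 either step is on the positive side; from 0 only the up-step is. *)
Lemma count_last_pos N m :
  count (fun s => (soj s == m.+1) && pos_edge (head true s) (behead s))
        (words N.+1) = (2 * nb_above N m + nb_end N m 0)%N.
Proof.
rewrite count_words_succ /nb_above /nb_end.
elim: (words N) => //= s w; rewrite /pos_edge /=; lia.
Qed.

Lemma count_last_pos0 N :
  count (fun s => (soj s == 0%N) && pos_edge (head true s) (behead s))
        (words N.+1) = 0%N.
Proof.
rewrite count_words_succ -[RHS]addn0.
by congr addn; apply: count_eq_pred0 => s; rewrite /= /pos_edge /=; lia.
Qed.

(** * Central binomial coefficients and Catalan numbers *)

Definition central (n : nat) : rat := 'C(2 * n, n)%:R.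

Definition catalan (n : nat) : rat := central n / n.+1%:R.

Lemma central_succ n :
  central n.+1 = (4 * n%:R + 2) / n.+1%:R * central n.
Proof.
have E : (n.+1 * 'C(2 * n.+1, n.+1) = (4 * n + 2) * 'C(2 * n, n))%N.
  have E1 : (2 * n.+1 * 'C((2 * n).+1, n) = n.+1 * 'C(2 * n.+1, n.+1))%N.
    by rewrite -mul_bin_diag mulnS.
  have /= E2 := mul_bin_diag (2 * n).+1 n.
  have E3 : 'C((2 * n).+1, n.+1) = 'C((2 * n).+1, n).
    by rewrite -bin_sub; [congr binomial; lia | lia].
  rewrite E3 in E2; rewrite -E1; nia.
have n0 : n.+1%:R != 0 :> rat by rewrite pnatr_eq0.
apply: (mulfI n0); rewrite mulrA (mulrC _ (_ / _)) divfK //.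
by rewrite /central -[LHS]natrM E natrM natrD natrM.
Qed.

(** * Meanders and ballot numbers *)

(* Walks of length L from 0 to x that stay positive after time 0. *)
Fixpoint meander (L x : nat) : nat :=
  match L, x with
  | 0, _ => x == 0%N
  | _.+1, 0 => 0
  | L'.+1, x'.+1 => meander L' x' + meander L' x'.+2
  end.

Lemma meander_succ L x :
  meander L.+1 x.+1 = (meander L x + meander L x.+2)%N.
Proof. by []. Qed.

Lemma meander_gt L x : (L < x)%N -> meander L x = 0%N.
Proof. by elim: L x => [|L IH] [|x] //= Lx; rewrite !IH //; lia. Qed.

Lemma meander_parity L x : odd L != odd x -> meander L x = 0%N.
Proof.
elim: L x => [|L IH] [|x] //= Lx; rewrite !IH //=; lia.
Qed.

(* Reflection principle, with the subtraction moved to the left-hand side. *)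
Lemma meander_reflection c x :
  (meander (2 * c + x).+1 x.+1 + (if c is c'.+1 then 'C(2 * c + x, c') else 0)
   = 'C(2 * c + x, c))%N.
Proof.
move E : (2 * c + x)%N => L; elim: L c x E => [|L IH] c x E.
  by have [-> ->] : c = 0%N /\ x = 0%N by lia.
case: c E => [|c] E.
  have -> : x = L.+1 by lia.
  rewrite meander_succ (@meander_gt _ L.+3) //.
  by have := IH 0%N L (erefl _); rewrite !bin0 !addn0.
have Ec : (2 * c + x.+1 = L)%N by lia.
have := IH c x.+1 Ec.
set m2 := meander L.+1 x.+2; set M := (if c is _.+1 then _ else _) => E2.
(* [M] is the binomial with lower index [c - 1], read as 0 at [c = 0], so Pascal's rule holds there
   too. *)
have EM : ('C(L.+1, c) = 'C(L, c) + M)%N.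
  by rewrite /M; case: (c) => [|c']; rewrite ?bin0 ?binS.
rewrite meander_succ -/m2.
case: x E {Ec} m2 E2 => [|x] E m2 E2.
  (* No meander arrives from height 0; the symmetry of the binomials for the odd [L = 2 * c + 1]
     makes up for the absent term. *)
  have sym : 'C(L, c.+1) = 'C(L, c).
    by rewrite -bin_sub; [congr binomial; lia | lia].
  rewrite binS EM sym [meander _ _]/=; lia.
have Ec1 : (2 * c.+1 + x = L)%N by lia.
have := IH c.+1 x Ec1.
rewrite binS EM; lia.
Qed.

(** After its first step, such a meander is a Dyck path of length [2 * c] above height 1, counted by
    the ballot difference of two binomials. *)
Lemma meander_catalan c : (meander (2 * c).+1 1)%:R = catalan c.
Proof.
have := meander_reflection c 0; rewrite addn0 /catalan /central => <-.
case: c => [|c]; first by rewrite /= addn0 divr1.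
have := meander_reflection c.+1 0; rewrite addn0.
set m := meander _ _ => E.
have := mul_bin_left (2 * c.+1) c; rewrite -E.
have -> : (2 * c.+1 - c = c.+2)%N by lia.
set B := 'C(_, c) => E1.
have E2 : c.+1%:R * (m + B)%:R = c.+2%:R * B%:R :> rat.
  by rewrite -!natrM E1.
have n0 : c.+2%:R != 0 :> rat by rewrite pnatr_eq0.
apply: (mulIf n0); rewrite divfK //.
move: E2; rewrite !natrD -[c.+2]addn1 natrD -[c.+1]addn1 !natrD; lra.
Qed.

(** * The Catalan convolution *)

(* Gosper antidifference of the terms of the Catalan convolution. *)
Definition catalan_antidiff (i r : nat) : rat :=
  (i%:R - r%:R) / (2 * (i + r)%:R * (i + r).+1%:R) * central i * central r.

Lemma catalan_antidiffC i r :
  catalan_antidiff r i = - catalan_antidiff i r.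
Proof. by rewrite /catalan_antidiff addnC -(opprB i%:R); ring. Qed.

(** Both antidifferences have index sum [i + k + 2], so these differences telescope along a
    convolution. *)
Lemma catalan_antidiff_succ i k :
  catalan_antidiff i.+1 k.+1 - catalan_antidiff i k.+2 =
  catalan i * catalan k.+1.
Proof.
rewrite /catalan_antidiff /catalan addSnnS.
rewrite !(central_succ i) (central_succ k.+1).
rewrite -!(natr1, natrD) -?[k.+2]addn1 -?[k.+1]addn1 -?[i.+1]addn1 !natrD.
field.
have := (ler0n rat i, ler0n rat k) => -[i0 k0].
by apply/and4P; split; apply: lt0r_neq0; lra.
Qed.

(** Peeling off [a = 0] trades [i], [k.+1] for [i.+1], [k]; hence the induction over all [i]. *)
Lemma catalan_partial_convolution i k :
  \sum_(a < k.+1) catalan (i + a) * catalan (k - a) =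
  catalan_antidiff (i + k.+1) 0 - catalan_antidiff i k.+1.
Proof.
elim: k i => [|k IH] i.
  rewrite big_ord1 addn0 subnn /catalan_antidiff /catalan.
  rewrite addn1 addn0 !(central_succ i) (central_succ 0).
  rewrite -?[i.+2]addn1 -?[i.+1]addn1 !natrD.
  have -> : central 0 = 1 by [].
  field; have i0 := ler0n rat i.
  by apply/andP; split; apply: lt0r_neq0; lra.
rewrite big_ord_recl addn0 subn0 /= -catalan_antidiff_succ.
under eq_bigr => a _ do rewrite -addSnnS subSS.
rewrite IH addSnnS; ring.
Qed.

(** * Decomposition at the last zero *)

(** For [2 * a > p] truncated subtraction would give length 0, and [meander 0 0] is 1; the guard
    excludes this. *)
Definition shifted_meander (p a x : nat) : nat :=
  if (2 * a <= p)%N then meander (p - 2 * a) x else 0.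

Lemma shifted_meander_succ p a x :
  shifted_meander p.+1 a x.+1 =
  (shifted_meander p a x + shifted_meander p a x.+2)%N.
Proof.
rewrite /shifted_meander; case: (leqP (2 * a) p) => ap.
  by rewrite leqW // subSn.
case: leqP => // ap'.
by have -> : (p.+1 - 2 * a = 0)%N by lia.
Qed.

(* Walks ending at x > 0, with p positive and 2i negative steps, by their
   last zero: the last p - 2a steps form a meander, and the preceding bridge
   can be chosen in [catalan (i + a)] ways. *)
Definition last_zero_sum (i p x : nat) : rat :=
  \sum_(a < p.+1) catalan (i + a) * (shifted_meander p a x)%:R.

Lemma last_zero_sum_succ i p x :
  last_zero_sum i p.+1 x.+1 = last_zero_sum i p x + last_zero_sum i p x.+2.
Proof.
(* The extra term [a = p.+1] has [2 * a > p.+1] and vanishes. *)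
rewrite /last_zero_sum big_ord_recr /=.
rewrite [shifted_meander _ p.+1 _]/shifted_meander leqNgt.
rewrite (_ : p.+1 < 2 * p.+1)%N; last by lia.
rewrite mulr0 addr0 -big_split; apply: eq_bigr => a _ /=.
by rewrite shifted_meander_succ natrD mulrDr.
Qed.

(** A meander ending at height 0 has length 0, so only [a = p./2] survives; this is the Chung-Feller
    value for bridges. *)
Lemma last_zero_sum_zero i p :
  last_zero_sum i p 0 = if odd p then 0 else catalan (i + p./2).
Proof.
have shifted0 a : shifted_meander p a 0 = (2 * a == p)%N.
  rewrite /shifted_meander; case: ltngtP => // ap.
    by case E: (p - 2 * a)%N => [|m] //; lia.
  by rewrite ap subnn.
rewrite /last_zero_sum; under eq_bigr do rewrite shifted0.
case: ifPn => podd.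
  by rewrite big1 // => a _; rewrite (_ : _ == _ = false) ?mulr0 //; lia.
have p2 : (p./2 < p.+1)%N by lia.
rewrite (bigD1 (Ordinal p2)) //= big1 => [|a].
  by rewrite (_ : _ == p) ?mulr1 ?addr0 //; lia.
by rewrite -val_eqE /= => ap; rewrite (_ : _ == _ = false) ?mulr0 //; lia.
Qed.

Lemma last_zero_sum_nil i x : last_zero_sum i 0 x.+1 = 0.
Proof. by rewrite /last_zero_sum big_ord1 mulr0. Qed.

Lemma last_zero_sum_parity i p x : odd p != odd x -> last_zero_sum i p x = 0.
Proof.
move=> px; rewrite /last_zero_sum big1 // => a _; rewrite /shifted_meander.
by case: leqP => ap; rewrite ?mulr0 // meander_parity ?mulr0 //; lia.
Qed.

Lemma last_zero_sum_one i k :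
  last_zero_sum i (2 * k).+1 1 =
  catalan_antidiff (i + k.+1) 0 - catalan_antidiff i k.+1.
Proof.
rewrite -catalan_partial_convolution /last_zero_sum.
rewrite [RHS](big_ord_widen (2 * k).+2
  (fun a => catalan (i + a) * catalan (k - a))); last by lia.
rewrite [RHS]big_mkcond; apply: eq_bigr => a _.
rewrite ltnS /shifted_meander.
have -> : (2 * a <= (2 * k).+1)%N = (a <= k)%N by lia.
case: leqP => ak; last by rewrite mulr0.
by rewrite -(meander_catalan (k - a)) mulnBr subSn // leq_mul2l.
Qed.

(** * Closed form of the endpoint counts *)

(** [p] counts the steps on the side of the endpoint, [q] those on the other side; the latter form
    complete excursions, so [q] must be even. *)
Definition end_formula (p q x : nat) : rat :=
  if odd q then 0 else last_zero_sum q./2 p x.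

Lemma end_formula_succ p q x :
  end_formula p.+1 q x.+1 = end_formula p q x + end_formula p q x.+2.
Proof.
by rewrite /end_formula; case: ifP => _; rewrite ?addr0 ?last_zero_sum_succ.
Qed.

Lemma end_formula_nil q x : end_formula 0 q x.+1 = 0.
Proof. by rewrite /end_formula last_zero_sum_nil; case: ifP. Qed.

Lemma end_formulaC p q : end_formula p q 0 = end_formula q p 0.
Proof.
by rewrite /end_formula !last_zero_sum_zero addnC; case: (odd p); case: (odd q).
Qed.

Lemma end_formula_one p q : ~~ odd p -> ~~ odd q -> (0 < p)%N ->
  end_formula p.-1 q 1 =
  catalan_antidiff (p./2 + q./2) 0 - catalan_antidiff q./2 p./2.
Proof.
move=> p_even q_even p_gt0; rewrite /end_formula (negbTE q_even).
have -> : p.-1 = (2 * (p./2).-1).+1 by lia.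
by rewrite last_zero_sum_one prednK 1?[in RHS]addnC //; lia.
Qed.

Lemma catalan_antidiff_full n :
  (0 < n)%N -> 2 * catalan_antidiff n 0 = catalan n.
Proof.
case: n => // n _; rewrite /catalan_antidiff /catalan addn0.
have -> : central 0 = 1 by [].
rewrite -[n.+2]addn1 -[n.+1]addn1 !natrD; field.
by have n0 := ler0n rat n; apply/andP; split; apply: lt0r_neq0; lra.
Qed.

(** For even [p] and [q], the antisymmetric parts of the two terms cancel and the two halves from
    [catalan_antidiff_full] add up to the Chung-Feller value; otherwise everything vanishes by
    parity. *)
Lemma end_formula_zero p q : (0 < p + q)%N ->
  end_formula p q 0 = (if p is p'.+1 then end_formula p' q 1 else 0) +
                      (if q is q'.+1 then end_formula q' p 1 else 0).
Proof.
move=> pq; have [[p_even q_even]|odd_pq] :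
    (~~ odd p /\ ~~ odd q) \/ (odd p || odd q) by case: (odd p) (odd q) => -[]; auto.
  have -> : (if p is p'.+1 then end_formula p' q 1 else 0) =
     catalan_antidiff (p./2 + q./2) 0 - catalan_antidiff q./2 p./2.
    case: p p_even {pq} => [|p] p_even; last by rewrite -end_formula_one.
    by rewrite add0n subrr.
  have -> : (if q is q'.+1 then end_formula q' p 1 else 0) =
     catalan_antidiff (q./2 + p./2) 0 - catalan_antidiff p./2 q./2.
    case: q q_even {pq} => [|q] q_even; last by rewrite -end_formula_one.
    by rewrite add0n subrr.
  rewrite (catalan_antidiffC p./2) (addnC p./2) /end_formula (negbTE q_even).
  rewrite last_zero_sum_zero (negbTE p_even) -catalan_antidiff_full; first ring.
  by lia.
have -> : end_formula p q 0 = 0.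
  rewrite /end_formula last_zero_sum_zero.
  by case: (odd p) odd_pq; case: (odd q).
have one0 a b : odd a.+1 || odd b -> end_formula a b 1 = 0.
  rewrite /end_formula; case: (odd b) => //.
  by rewrite orbF /= => oa; rewrite last_zero_sum_parity //= eqb_id.
case: p q {pq} odd_pq => [|p] [|q] //= odd_pq; rewrite ?one0 ?addr0 //.
all: by rewrite orbC.
Qed.

(** Both sides obey the same last-step recurrence. The two signs are proved together because the
    recurrence at 0 uses both neighbours 1 and -1. *)
Lemma nb_end_formula p q (x : nat) :
  (nb_end (p + q) p x%:Z)%:R = end_formula p q x /\
  (nb_end (p + q) q (- x%:Z))%:R = end_formula p q x.
Proof.
move E: (p + q)%N => N; elim: N p q x E => [|N IH] p q x E.
  have [-> ->] : p = 0%N /\ q = 0%N by lia.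
  case: x => [|x]; last by rewrite end_formula_nil.
  by rewrite /end_formula last_zero_sum_zero.
have IHpos p' q' x' : (p' + q')%N = N ->
    (nb_end N p' x'%:Z)%:R = end_formula p' q' x' by move=> pq; have [] := IH p' q' x' pq.
have IHneg p' q' x' : (p' + q')%N = N ->
    (nb_end N q' (- x'%:Z))%:R = end_formula p' q' x' by move=> pq; have [] := IH p' q' x' pq.
case: x => [|x].
  rewrite oppr0.
  have zero p' q' : (p' + q' = N.+1)%N ->
      (nb_end N.+1 p' 0)%:R = end_formula p' q' 0.
    case: p' => [|p'] E'; rewrite end_formula_zero ?E' //.
      move: E'; rewrite add0n => ->.
      by rewrite nb_end_zero0 add0r (IHneg N 0%N 1%N) ?addn0.
    rewrite nb_end_zero addnC natrD (IHpos p' q' 1%N); last by lia.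
    (* For [q' = 0] the sojourn time [p'.+1] exceeds the length [N], so nothing arrives from -1. *)
    case: q' E' => [|q'] E'; first by rewrite nb_end_gt //; lia.
    by rewrite (IHneg q' p'.+1 1%N) //; lia.
  split; first exact: zero.
  by rewrite end_formulaC; apply: zero; rewrite addnC.
case: p E => [|p] E.
  rewrite end_formula_nil nb_end_pos0 nb_end_neg.
  by rewrite !nb_end_gt //; lia.
have {}E : (p + q)%N = N by lia.
rewrite nb_end_pos nb_end_neg end_formula_succ !natrD.
by rewrite !(IHpos p q) // !(IHneg p q) // [X in _ /\ X = _]addrC.
Qed.

(** * Forgetting the endpoint *)

(** Two uses of [nb_above_succ] raise [k] by one; parity kills one endpoint term in each. *)
Lemma nb_above_odd i k :
  (nb_above (2 * (i + k)).+1 (2 * k).+1)%:R =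
  k.+1%:R / (2 * (i + k).+1%:R) * central k.+1 * central i.
Proof.
have step N m : (nb_above N.+1 m.+1)%:R = 2 * (nb_above N m)%:R
    + (nb_end N m 0)%:R - (nb_end N m 1)%:R :> rat.
  by rewrite -natrM -natrD -nb_above_succ natrD addrK.
have end0 p q : (nb_end (p + q) p 0)%:R = end_formula p q 0.
  by have [] := nb_end_formula p q 0.
have end1 p q : (nb_end (p + q) p 1)%:R = end_formula p q 1.
  by have [] := nb_end_formula p q 1.
have even0 k' : (nb_end (2 * (i + k')) (2 * k') 0)%:R = catalan (i + k').
  rewrite mulnDr addnC end0 /end_formula last_zero_sum_zero.
  by rewrite !mul2n !odd_double !doubleK.
have even1 k' : (nb_end (2 * (i + k')) (2 * k') 1)%:R = 0 :> rat.
  rewrite mulnDr addnC end1 /end_formula !mul2n odd_double.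
  by rewrite last_zero_sum_parity ?odd_double.
elim: k => [|k IH].
  rewrite step nb_above_zero even0 even1 addn0 /catalan.
  rewrite (central_succ 0) (_ : central 0 = 1) // -[i.+1]addn1 natrD.
  by field; rewrite natr1 pnatr_eq0.
rewrite step even0 even1.
have -> : (2 * (i + k.+1) = (2 * (i + k)).+2)%N by lia.
have -> : (2 * k.+1 = (2 * k).+2)%N by lia.
rewrite step IH.
have -> : (2 * (i + k)).+1 = ((2 * k).+1 + 2 * i)%N by lia.
rewrite end0 end1 /end_formula last_zero_sum_zero last_zero_sum_one.
rewrite !mul2n /= !odd_double doubleK /=.
(* The Catalan number is [2 * A] and the endpoint 1 contributes [- 2 * A], so [A] cancels and a
   first-order recurrence remains. *)
rewrite -(@catalan_antidiff_full (i + k.+1)); last by rewrite addnS.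
set A := catalan_antidiff _ 0; rewrite /catalan_antidiff (central_succ k.+1).
rewrite !addnS -[k.+2]addn1 -[k.+1]addn1 -[(i + k).+2]addn1 -[(i + k).+1]addn1.
rewrite !natrD /=; field.
have := (ler0n rat i, ler0n rat k) => -[i0 k0].
by do ?[apply/andP; split]; apply: lt0r_neq0; lra.
Qed.

Theorem theorem5 (n k : nat) (hn : (1 <= n)%N) (hk : (k <= n)%N) :
  #|walks_sojourn_pos (2 * n) (2 * k)|%:R =
    k%:R / n%:R * 'C(2 * k, k)%:R * 'C(2 * n - 2 * k, n - k)%:R :> rat.
Proof.
case: n hn hk => // n _ hk; rewrite mulnS card_walks_sojourn_pos.
case: k hk => [|k] hk.
  by rewrite !mul0r muln0 count_last_pos0.
rewrite mulnS count_last_pos natrD natrM.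
(* [i] is half the number of steps off the positive side. *)
have [i ->] : exists i, (n = i + k)%N by exists (n - k)%N; lia.
rewrite nb_above_odd.
(* The remaining term counts walks at 0 at an odd time, so it vanishes. *)
have -> : (2 * (i + k)).+1 = ((2 * k).+1 + 2 * i)%N by lia.
have [-> _] := nb_end_formula (2 * k).+1 (2 * i) 0.
rewrite /end_formula last_zero_sum_zero !mul2n /= !odd_double /= addr0.
have -> : 'C(2 + k.*2, k.+1)%:R = central k.+1 by rewrite /central mulnS mul2n.
have -> : 'C(2 + (i + k).*2 - (2 + k.*2), (i + k).+1 - k.+1)%:R = central i.
  by rewrite subSS addnK subnDl doubleD addnK /central mul2n.
field; have := (ler0n rat i, ler0n rat k) => -[i0 k0].
by apply: lt0r_neq0; lra.
Qed.
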